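(* Let $F_0:A_0\to[0,\infty)$ be a conic Finsler metric on a manifold $M$, with fundamental tensor $g^0$ and angular metric $h^0$, and let $\beta$ be a one-form on $M$. Let $F=F_0+\beta$ on $A=\{v\in A_0:F_0(v)+\beta(v)>0\}$, assuming $\pi(A)=M$. Then $F$ is a conic Finsler metric on all $A$, with fundamental tensor $$g_v(w,w)=\frac{F_0(v)+\beta(v)}{F_0(v)}h^0_v(w,w)+\Big(\frac{g^0_v(v,w)}{F_0(v)}+\beta(w)\Big)^2,$$ for any $v\in A\setminus0$ and $w\in T_{\pi(v)}M$.
   Context: Let $\pi:TM\to M$ be the natural projection. A conic Finsler metric on $M$ with domain $A$ is a continuous function $F:A\to[0,\infty)$, where $A\subset TM$ is open with $\pi(A)=M$ and conic ($v\in A$, $\lambda>0$ imply $\lambda v\in A$), which is smooth on $A$ except at most at the zero vectors, with $F(v)=0$ iff $v$ is a zero vector, $F(\lambda v)=\lambda F(v)$ for $\lambda>0$, $v\in A$, and whose fundamental tensor $g_v(u,w)=\frac12\frac{\partial^2}{\partial t\partial s}F(v+tu+sw)^2|_{t=s=0}$ ($u,w\in T_{\pi(v)}M$) is positive definite for all $v\in A\setminus0$ (nonzero vectors of $A$). The angular metric of $F_0$ is $h^0_v(w,w)=g^0_v(w,w)-\frac1{F_0(v)^2}g^0_v(v,w)^2$. *)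

(* Defs.v *)
From HB Require Import structures.
From mathcomp Require Import all_boot all_order all_algebra.
From mathcomp Require Import all_classical all_reals all_analysis.

Set Implicit Arguments.
Unset Strict Implicit.
Unset Printing Implicit Defensive.

Import Order.TTheory GRing.Theory Num.Theory.
Import numFieldNormedType.Exports.

Local Open Scope classical_set_scope.
Local Open Scope ring_scope.

(* C^k and C^oo maps on an open subset U of a finite-dimensional space V: all
   iterated directional derivatives up to order k exist and are continuous.
   Nothing is asked of f outside U. *)
Fixpoint Ck (R : realType) (V W : normedModType R) (k : nat) (U : set V)
    (f : V -> W) : Prop :=
  {in U, continuous f} /\
  if k is k'.+1 then
    (forall x v, U x -> derivable f x v) /\ forall v, Ck k' U ('D_v f)
  else True.

Definition Cinfty (R : realType) (V W : normedModType R) (U : set V)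
  (f : V -> W) : Prop := forall k, Ck k U f.

(* A smooth manifold of dimension n, presented by a smooth atlas (which need
   not be maximal). Charts and their inverses are total functions, meaningful
   only on [chart_dom i] and on its image respectively. *)
Record smoothManifold (R : realType) (n : nat) := SmoothManifold {
  mcarrier :> topologicalType ;
  m_hausdorff : hausdorff_space mcarrier ;
  m_second_countable : @second_countable mcarrier ;
  chart_index : Type ;
  chart_dom : chart_index -> set mcarrier ;
  chart : chart_index -> mcarrier -> 'rV[R]_n ;
  chart_inv : chart_index -> 'rV[R]_n -> mcarrier ;
  chart_dom_open : forall i, open (chart_dom i) ;
  chart_img_open : forall i, open (chart i @` chart_dom i) ;
  chart_cover : forall p, exists i, chart_dom i p ;
  chartK : forall i p, chart_dom i p -> chart_inv i (chart i p) = p ;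
  chart_continuous : forall i, {in chart_dom i, continuous (chart i)} ;
  chart_inv_continuous : forall i,
    {in chart i @` chart_dom i, continuous (chart_inv i)} ;
  chart_transition : forall i j,
    Cinfty (chart i @` (chart_dom i `&` chart_dom j))
           (chart j \o chart_inv i)
}.

Section TangentSpace.
Context {R : realType} {n : nat} (M : smoothManifold R n) (p : M).

(* A tangent vector at p is the family of its coordinate vectors in all the
   charts around p, these being related by the differentials of the transition
   maps; the coordinates in the charts not containing p are set to 0. *)
Definition is_tangent (v : chart_index M -> 'rV[R]_n) : bool :=
  `[< (forall i, ~ chart_dom i p -> v i = 0) /\
      (forall i j, chart_dom i p -> chart_dom j p ->
         v j = 'd (chart j \o chart_inv i) (chart i p) (v i)) >].

Record tangent := Tangent {
  tcoord :> chart_index M -> 'rV[R]_n ;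
  tangentP : is_tangent tcoord
}.

HB.instance Definition _ := [isSub for tcoord].
HB.instance Definition _ := [Choice of tangent by <:].

Fact is_tangent_submod : submod_closed is_tangent.
Proof.
split=> [|a u v /asboolP[u0 uP] /asboolP[v0 vP]]; apply/asboolP; split=> //.
- by move=> i j _ _; rewrite linear0.
- by move=> i pi; rewrite !fctE /= u0 // v0 // scaler0 addr0.
- move=> i j ip jp; rewrite !fctE /= (uP i j) // (vP i j) //.
  by rewrite linearP.
Qed.

HB.instance Definition _ :=
  GRing.isSubmodClosed.Build _ _ is_tangent is_tangent_submod.
HB.instance Definition _ := [SubChoice_isSubLmodule of tangent by <:].

End TangentSpace.
Arguments tangent {R n M} p.

(* A dedicated record rather than a sigma type, since the latter carries the
   disjoint-union topology. *)
Record tangentBundle (R : realType) (n : nat) (M : smoothManifold R n) := TVec {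
  foot : M ;
  tvec : tangent foot
}.
Arguments TVec {R n M} foot tvec.
Arguments foot {R n M} _.
Arguments tvec {R n M} _.

Section TangentBundle.
Context {R : realType} {n : nat} (M : smoothManifold R n).
Local Notation TM := (tangentBundle M).
Local Notation E := ('rV[R]_n * 'rV[R]_n)%type.

Definition tchart_dom (i : chart_index M) : set TM :=
  [set u | chart_dom i (foot u)].

Definition tchart (i : chart_index M) (u : TM) : E :=
  (chart i (foot u), tvec u i).

HB.instance Definition _ := gen_eqMixin TM.
HB.instance Definition _ := gen_choiceMixin TM.

(* W is open iff in every bundle chart it corresponds to an open set. *)
Definition tb_open (W : set TM) : Prop :=
  forall i, exists2 U : set E, open U &
    tchart_dom i `&` W = tchart_dom i `&` tchart i @^-1` U.

Fact tb_openT : tb_open setT.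
Proof. by move=> i; exists setT; [exact: openT | rewrite preimage_setT]. Qed.

Fact tb_openI : setI_closed tb_open.
Proof.
move=> A B opA opB i; have [U oU AU] := opA i; have [V oV BV] := opB i.
exists (U `&` V); first exact: openI.
by rewrite preimage_setI setIIr AU BV -setIIr.
Qed.

Fact tb_open_bigU (I : Type) (f : I -> set TM) :
  (forall i, tb_open (f i)) -> tb_open (\bigcup_i f i).
Proof.
move=> opf i; have /choice[U UP] : forall k, exists U : set E, open U /\
    tchart_dom i `&` f k = tchart_dom i `&` tchart i @^-1` U.
  by move=> k; have [U] := opf k i; exists U.
exists (\bigcup_k U k); first by apply: bigcup_open => k _; have [] := UP k.
rewrite preimage_bigcup !setI_bigcupr; apply: eq_bigcupr => k _.
by have [] := UP k.
Qed.

HB.instance Definition _ :=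
  isOpenTopological.Build TM tb_openT tb_openI tb_open_bigU.

(* Smoothness of a function on an open subset W of TM, read in the bundle
   charts. *)
Definition tb_smooth (W : set TM) (F : TM -> R) : Prop :=
  forall i, exists2 f : E -> R,
    Cinfty (tchart i @` (tchart_dom i `&` W)) f &
    forall u, tchart_dom i u -> W u -> F u = f (tchart i u).

(* A (smooth) one-form: a linear form on each tangent space, whose component
   functions are smooth in every chart. *)
Record oneForm := OneForm {
  oneform_at : forall p : M, {scalar tangent p} ;
  oneform_smooth : forall i, exists2 b : 'rV[R]_n -> 'rV[R]_n,
    Cinfty (chart i @` chart_dom i) b &
    forall (p : M) (v : tangent p), chart_dom i p ->
      oneform_at p v = \sum_(j < n) b (chart i p) 0 j * v i 0 j
}.

Definition oneform_eval (beta : oneForm) (u : TM) : R :=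
  oneform_at beta (foot u) (tvec u).

(* g_v(u,w) = 1/2 d^2/dtds F(v + tu + sw)^2 at t = s = 0 *)
Definition fundamental_tensor (F : TM -> R) (p : M) (v u w : tangent p) : R :=
  2^-1 *
  derive1 (fun t : R =>
    derive1 (fun s : R => F (TVec p (v + t *: u + s *: w)) ^+ 2) 0) 0.

(* The quadratic form w |-> h_v(w,w). *)
Definition angular_metric (F : TM -> R) (p : M) (v w : tangent p) : R :=
  fundamental_tensor F v w w -
  1 / F (TVec p v) ^+ 2 * fundamental_tensor F v v w ^+ 2.

Definition zero_vectors : set TM := [set u | tvec u = 0].

Definition tb_conic (A : set TM) : Prop :=
  forall (p : M) (v : tangent p) (lambda : R),
    A (TVec p v) -> 0 < lambda -> A (TVec p (lambda *: v)).

(* F is a total function, but only its values on A matter. *)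
Record conic_finsler_metric (A : set TM) (F : TM -> R) : Prop := ConicFinsler {
  cf_open : open A ;
  cf_conic : tb_conic A ;
  cf_proj : foot @` A = setT ;
  cf_ge0 : forall u, A u -> 0 <= F u ;
  cf_continuous : {within A, continuous F} ;
  cf_smooth : tb_smooth (A `\` zero_vectors) F ;
  cf_eq0 : forall u, A u -> (F u = 0 <-> zero_vectors u) ;
  cf_homogeneous : forall (p : M) (v : tangent p) (lambda : R),
    A (TVec p v) -> 0 < lambda ->
    F (TVec p (lambda *: v)) = lambda * F (TVec p v) ;
  cf_posdef : forall (p : M) (v : tangent p),
    A (TVec p v) -> v <> 0 ->
    forall w : tangent p, w <> 0 -> 0 < fundamental_tensor F v w w
}.

End TangentBundle.

(* Main.v *)
(* Along the line s |-> v + s w put f(s) = F0(v + s w), which is C^2 near 0.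
   Then g0_v(w,w) = f'^2 + f f'' at 0, and homogeneity gives g0_v(v,w) = f f',
   so h0_v(w,w) = f f''.  Replacing f by f + beta(v) + s beta(w) leaves f''
   unchanged and adds beta(w) to f', which is the formula.

   For positivity, let c = f'/f.  By homogeneity
   F0(v + s (w - c v)) = (1 - c s) f(s / (1 - c s)); this function has the second
   derivative f'' and first derivative 0 at s = 0, so f f'' = g0_v(w - c v, w - c v).
   This is positive unless w = c v, in which case f'' = 0 and the square equals
   c^2 (F0 + beta)^2 (v).

   No zero vector lies in A, so openness of A and smoothness of F need only be
   read in the charts of the complement of the zero section.  These steps require
   that the image of a bundle chart be open, i.e. that every coordinate vector come
   from a tangent vector; this uses the chain rule for the transition maps, hence
   their differentiability, which follows from the continuity of their directional
   derivatives. *)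
From HB Require Import structures.
Require Import Defs.
From mathcomp Require Import all_boot all_order all_algebra.
From mathcomp Require Import all_classical all_reals all_analysis.
From mathcomp Require Import ring lra.
Set Implicit Arguments.
Unset Strict Implicit.
Unset Printing Implicit Defensive.
Import Order.TTheory GRing.Theory Num.Theory.
Import numFieldNormedType.Exports.
Local Open Scope classical_set_scope.
Local Open Scope ring_scope.

(** * Second derivatives on the real line *)

(** [derive1] is total, so derivability is required on a neighbourhood of [a] for the inner
    derivative to be a genuine one wherever the outer limit looks at it. *)
Definition twice_derivable (R : realType) (f : R -> R) (a : R) : Prop :=
  (\forall t \near a, derivable f t 1) /\ derivable (derive1 f) a 1.

Lemma near_eq_derive1 (R : realType) (f g : R -> R) (a : R) :
  (\forall t \near a, f t = g t) -> derive1 f a = derive1 g a.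
Proof. by move=> fg; rewrite !derive1E; exact: near_eq_derive. Qed.

Lemma near_eq_near_derive1 (R : realType) (f g : R -> R) (a : R) :
  (\forall t \near a, f t = g t) -> \forall t \near a, derive1 f t = derive1 g t.
Proof.
by move/near_join; apply: filterS => t; exact: near_eq_derive1.
Qed.

(** The working tool for second derivatives: a closed form [df] that is correct only near [a]
    suffices, since a derivative at [a] depends on the germ alone. *)
Lemma near_is_derive_twice (R : realType) (f df : R -> R) (a d2f : R) :
  (\forall t \near a, is_derive (t : R) (1 : R) f (df t)) -> is_derive a 1 df d2f ->
  [/\ twice_derivable f a, derive1 f a = df a & derive1 (derive1 f) a = d2f].
Proof.
move=> f1 f2.
have E : \forall t \near a, df t = derive1 f t.
  by apply: filterS f1 => t ft; rewrite derive1E; case: ft.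
have [D2 V2] := near_eq_is_derive E f2.
split; last by rewrite derive1E.
- split; last by [].
  by apply: filterS f1 => t [].
- by rewrite (nbhs_singleton E).
Qed.

Lemma twice_derivable_near (R : realType) (f : R -> R) (a : R) :
  twice_derivable f a ->
  (\forall t \near a, is_derive (t : R) (1 : R) f (derive1 f t)) /\
  is_derive a 1 (derive1 f) (derive1 (derive1 f) a).
Proof.
move=> [f1 f2]; split.
- by apply: filterS f1 => t ft; rewrite derive1E; exact: derivableP.
- by rewrite [derive1 (derive1 f) a]derive1E; exact: derivableP.
Qed.

Lemma near_eq_twice_derivable (R : realType) (f g : R -> R) (a : R) :
  (\forall t \near a, f t = g t) -> twice_derivable f a -> twice_derivable g a.
Proof.
move=> fg [f1 f2]; split.
- move/near_join: fg; apply: filterS2 f1 => t ft fg.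
  exact: near_eq_derivable ft.
- exact: (near_eq_derivable (near_eq_near_derive1 fg)).
Qed.

Lemma second_derive_sqr (R : realType) (f : R -> R) (a : R) :
  twice_derivable f a ->
  derive1 (derive1 (f ^+ 2)) a =
    2 * (derive1 f a ^+ 2 + f a * derive1 (derive1 f) a).
Proof.
move=> f2; have [d1 d2] := twice_derivable_near f2.
have [|| _ _ ->] := @near_is_derive_twice _ (f ^+ 2) (fun t => 2 * (f t * derive1 f t)) a
   (2 * (derive1 f a ^+ 2 + f a * derive1 (derive1 f) a)); last by [].
- apply: filterS d1 => t dt.
  apply: (is_derive_eq (is_deriveX 2 dt)).
  by rewrite /GRing.scale /=; ring.
- apply: (is_derive_eq (is_deriveM (is_derive_cst (2 : R) a 1)
    (is_deriveM (nbhs_singleton d1) d2))).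
  by rewrite /GRing.scale /=; ring.
Qed.

Lemma is_derive_affine (R : realType) (a b t : R) :
  is_derive t 1 (fun s => a + s * b) b.
Proof.
apply: (is_derive_eq (is_deriveD (is_derive_cst a t 1)
  (is_deriveM (is_derive_id t 1) (is_derive_cst b t 1)))).
by rewrite /GRing.scale /=; ring.
Qed.

(** Along a line in a fibre a one-form is an affine function of the parameter, so this describes the
    effect of adding it. *)
Lemma add_affine_twice (R : realType) (f : R -> R) (a b c : R) :
  twice_derivable f c ->
  [/\ twice_derivable (fun s => f s + (a + s * b)) c,
      derive1 (fun s => f s + (a + s * b)) c = derive1 f c + b &
      derive1 (derive1 (fun s => f s + (a + s * b))) c = derive1 (derive1 f) c].
Proof.
move=> f2; have [d1 d2] := twice_derivable_near f2.
apply: (@near_is_derive_twice _ _ (fun s => derive1 f s + b)).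
- by apply: filterS d1 => t dt; exact: is_deriveD dt (is_derive_affine _ _ _).
- apply: (is_derive_eq (is_deriveD d2 (is_derive_cst b c 1))).
  exact: addr0.
Qed.

(** * The projective change of parameter s / (1 - c s) *)

Section Reparametrization.
Context {R : realType}.
Variables (f : R -> R) (c : R).
Hypothesis f2 : twice_derivable f 0.

Let den (s : R) := 1 + s * - c.
Let q (s : R) := s * (den s)^-1.

Let den0 : den 0 = 1.
Proof. by rewrite /den mul0r addr0. Qed.

Let q0 : q 0 = 0.
Proof. by rewrite /q mul0r. Qed.

Let is_derive_q (s : R) : 0 < den s -> is_derive s 1 q ((den s) ^- 2).
Proof.
move=> s0; have n0 : den s != 0 by rewrite gt_eqF.
apply: (is_derive_eq (is_deriveM (is_derive_id s 1)
   (is_deriveV n0 (is_derive_affine 1 (- c) s)))).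
by rewrite /GRing.scale /= /den; field.
Qed.

Lemma near_perspective_den : \forall s \near (0 : R), 0 < den s.
Proof.
have /differentiable_continuous : differentiable den 0.
  by apply/derivable1_diffP; case: (is_derive_affine 1 (- c) 0).
by move/cvgr_gt; apply; rewrite den0 ltr01.
Qed.

Lemma near_perspective (P : R -> Prop) :
  (\forall s \near 0, P s) -> \forall s \near 0, P (q s).
Proof.
have : q @ 0 --> q 0.
  apply/differentiable_continuous/derivable1_diffP.
  by have [] := is_derive_q (nbhs_singleton near_perspective_den).
by rewrite q0; apply.
Qed.

(** Since q' = 1 / den^2, the first derivative of [g] is f'(q) / den - c f(q). Differentiating
    again, the two terms in f'(q) cancel and f''(q) / den^3 remains. *)
Lemma second_derive_perspective :
  let g s := den s * f (q s) in
  [/\ twice_derivable g 0, derive1 g 0 = derive1 f 0 - c * f 0 &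
      derive1 (derive1 g) 0 = derive1 (derive1 f) 0].
Proof.
move=> g; have [d1 d2] := twice_derivable_near f2.
have [|| G2 G0 G1] := @near_is_derive_twice _ g
  (fun s => (derive1 f \o q) s * (den s)^-1 - c * (f \o q) s) 0
  (derive1 (derive1 f) 0).
- near=> s.
  have s0 : 0 < den s by near: s; exact: near_perspective_den.
  have fs : is_derive (q s) (1 : R) f (derive1 f (q s)).
    by near: s; exact: near_perspective d1.
  apply: (is_derive_eq (is_deriveM (is_derive_affine 1 (- c) s)
    (is_derive1_comp fs (is_derive_q s0)))).
  have n0 : den s != 0 by rewrite gt_eqF.
  by rewrite /GRing.scale /= -/(den s); field.
- have s0 := nbhs_singleton near_perspective_den.
  have n0 : den 0 != 0 by rewrite gt_eqF.
  have e1 := nbhs_singleton (near_perspective d1).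
  (* The base point 0 is rewritten as [q 0] so that the chain rule applies. *)
  have e2 := d2; rewrite -[X in is_derive X]q0 in e2.
  have h1 := is_derive1_comp e2 (is_derive_q s0).
  have h2 := is_deriveV n0 (is_derive_affine 1 (- c) 0).
  have h3 := is_deriveM (is_derive_cst c (0 : R) (1 : R)) (is_derive1_comp e1 (is_derive_q s0)).
  have h4 := is_deriveB (is_deriveM h1 h2) h3.
  apply: (is_derive_eq h4).
  by rewrite /GRing.scale /= den0 q0; field.
- move: G0; rewrite /= q0 den0 invr1 mulr1 => G0.
  by split; [exact: G2 | exact: G0 | exact: G1].
Unshelve. all: by end_near. Qed.

End Reparametrization.

(** * The fundamental tensor along a line *)

Section FundamentalTensor.
Context {R : realType} {n : nat} {M : smoothManifold R n}.
Implicit Types (A : set (tangentBundle M)) (F : tangentBundle M -> R) (p : M).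

Definition line_fun F p (v w : tangent p) (s : R) : R :=
  F (TVec p (v + s *: w)).

Lemma line_fun0 F p (v w : tangent p) : line_fun F v w 0 = F (TVec p v).
Proof. by rewrite /line_fun scale0r addr0. Qed.

(** With both directions equal to [w], the argument depends on t + s only, so the mixed derivative
    is the second derivative of [f ^+ 2]. *)
Lemma fundamental_tensor_diag F p (v w : tangent p) (f := line_fun F v w) :
  twice_derivable f 0 ->
  fundamental_tensor F v w w =
    derive1 f 0 ^+ 2 + F (TVec p v) * derive1 (derive1 f) 0.
Proof.
move=> f2; rewrite -(line_fun0 F v w) -/f.
(* This holds for every t: the difference quotients defining the two derivatives coincide. *)
have E : (fun t : R => derive1 (fun s => F (TVec p (v + t *: w + s *: w)) ^+ 2) 0)
    = derive1 (f ^+ 2).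
  apply/funext => t; rewrite /derive1.
  have -> : (fun h : R => h^-1 *: (F (TVec p (v + t *: w + (h + 0) *: w)) ^+ 2 -
      F (TVec p (v + t *: w + 0 *: w)) ^+ 2)) =
    (fun h : R => h^-1 *: ((f ^+ 2) (h + t) - (f ^+ 2) t)); last by [].
  apply/funext => h; rewrite exprfctE /f /line_fun addr0 scale0r addr0.
  by rewrite -addrA -scalerDl (addrC t h).
rewrite /fundamental_tensor E.
by rewrite second_derive_sqr; [field | exact: f2].
Qed.

Section Homogeneous.
Variables (A : set (tangentBundle M)) (F : tangentBundle M -> R).
Hypothesis Fhom : forall (p : M) (v : tangent p) (lambda : R),
  A (TVec p v) -> 0 < lambda ->
  F (TVec p (lambda *: v)) = lambda * F (TVec p v).
Variables (p : M) (v w : tangent p).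
Hypothesis Aline : \forall s \near (0 : R), A (TVec p (v + s *: w)).
Let f := line_fun F v w.
Hypothesis f2 : twice_derivable f 0.

(* Homogeneity reduces F (v + t v + s w) to (1 + t) F (v + s / (1 + t) w). *)
Lemma fundamental_tensor_radial :
  fundamental_tensor F v v w = F (TVec p v) * derive1 f 0.
Proof.
rewrite -(line_fun0 F v w) -/f.
have d0 : is_derive 0 (1 : R) f (derive1 f 0).
  exact: nbhs_singleton (twice_derivable_near f2).1.
(* The inner derivative is (1 + t) times the constant 2 f(0) f'(0). It is written as an affine
   function plus a constant to match the derivative rules used at the end. *)
have E : \forall t \near (0 : R),
    0 + t * (2 * (f 0 * derive1 f 0)) + 2 * (f 0 * derive1 f 0) =
    derive1 (fun s : R => F (TVec p (v + t *: v + s *: w)) ^+ 2) 0.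
  near=> t.
  have t0 : 0 < 1 + t.
    rewrite -ltrBlDl sub0r; near: t; apply: lt_nbhsr; exact: ltrN10.
  have tn : 1 + t != 0 by rewrite gt_eqF.
  have H : \forall s \near (0 : R),
      (f (0 + s * (1 + t)^-1) * (1 + t)) ^+ 2 =
      F (TVec p (v + t *: v + s *: w)) ^+ 2.
    (* Homogeneity is available only at vectors of [A]; continuity of [q] at 0 keeps the rescaled
       line in [A]. *)
    pose q (s : R) := 0 + s * (1 + t)^-1.
    have qC : {for 0, continuous q}.
      apply/differentiable_continuous/derivable1_diffP.
      by have [] := is_derive_affine 0 (1 + t)^-1 0.
    have Aq : nbhs (q 0) [set s | A (TVec p (v + s *: w))].
      by rewrite /q mul0r addr0.
    have qA : \forall s \near (0 : R), A (TVec p (v + q s *: w)) by exact: qC _ Aq.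
    apply: filterS qA => s; rewrite /q add0r => As.
    rewrite mulrC; congr (_ ^+ 2).
    rewrite /f /line_fun -(Fhom As t0); congr (F (TVec p _)).
    by rewrite scalerDr scalerA mulrCA mulfV// mulr1 scalerDl scale1r.
  rewrite -(near_eq_derive1 H) [RHS]derive1E.
  have d1 : is_derive (0 + 0 * (1 + t)^-1) (1 : R) f (derive1 f 0).
    by rewrite mul0r addr0.
  have d2 := @is_derive1_comp R f (fun s => 0 + s * (1 + t)^-1) 0 _ _ d1
    (is_derive_affine 0 (1 + t)^-1 0).
  have d3 := is_deriveX 2 (is_deriveM d2 (is_derive_cst (1 + t) (0 : R) (1 : R))).
  have d4 : is_derive (0 : R) (1 : R)
      (fun s : R => (f (0 + s * (1 + t)^-1) * (1 + t)) ^+ 2)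
      (0 + t * (2 * (f 0 * derive1 f 0)) + 2 * (f 0 * derive1 f 0)).
    apply: (is_derive_eq d3).
    rewrite mulrfctE /GRing.scale /= mul0r addr0.
    by field.
  exact: (esym (@derive_val _ _ _ _ _ _ _ d4)).
rewrite /fundamental_tensor -(near_eq_derive1 E) derive1E.
have [_ ->] := is_deriveD (is_derive_affine 0 (2 * (f 0 * derive1 f 0)) 0)
  (is_derive_cst (2 * (f 0 * derive1 f 0)) (0 : R) (1 : R)).
by rewrite addr0; field.
Unshelve. all: by end_near. Qed.

(** The radial term squared and divided by F(v)^2 is f'^2, which cancels the first summand of
    [fundamental_tensor_diag]. *)
Lemma angular_metricE : F (TVec p v) != 0 ->
  angular_metric F v w = F (TVec p v) * derive1 (derive1 f) 0.
Proof.
move=> F0; rewrite /angular_metric fundamental_tensor_radial.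
by rewrite fundamental_tensor_diag; [rewrite -/f; field | exact: f2].
Qed.

(** The condition on [c] makes the derivative of [F] at [v] along w - c v vanish, so that only the
    second-order term survives there. *)
Lemma fundamental_tensor_transverse (c : R) :
  F (TVec p v) * c = derive1 f 0 ->
  fundamental_tensor F (v : tangent p) (w - c *: v) (w - c *: v) =
    F (TVec p v) * derive1 (derive1 f) 0.
Proof.
move=> Fc; have [g2 g0 g1] := second_derive_perspective c f2.
(* v + s (w - c v) = (1 - c s) (v + s / (1 - c s) w), followed by homogeneity. *)
have E : \forall s \near (0 : R),
    (1 + s * - c) * f (s * (1 + s * - c)^-1) = line_fun F v (w - c *: v) s.
  apply: filterS2 (near_perspective_den c) (near_perspective c Aline) => s s0 As.
  have sn : 1 + s * - c != 0 by rewrite gt_eqF.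
  rewrite /f /line_fun -(Fhom As s0); congr (F (TVec p _)).
  rewrite scalerDr scalerA mulrCA (mulfV sn) mulr1 scalerDl scale1r.
  by rewrite mulrN scaleNr scalerBr scalerA addrAC addrA.
rewrite fundamental_tensor_diag; last exact: near_eq_twice_derivable E g2.
rewrite -(nbhs_singleton (near_eq_near_derive1 E)) g0.
rewrite -(near_eq_derive1 (near_eq_near_derive1 E)) g1 -Fc.
by rewrite -(line_fun0 F v w) -/f (mulrC c) subrr expr0n add0r.
Qed.
End Homogeneous.
End FundamentalTensor.

(** * Calculus of C^k maps *)

Section CkTheory.
Context {R : realType}.

Lemma CkS (V W : normedModType R) k (U : set V) (f : V -> W) :
  Ck k.+1 U f -> Ck k U f.
Proof.
elim: k f => [|k IH] f [cf [df Df]]; first by split.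
by split=> //; split=> // v; apply: IH.
Qed.

Lemma CkW (V W : normedModType R) k (U U' : set V) (f : V -> W) :
  U' `<=` U -> Ck k U f -> Ck k U' f.
Proof.
move=> UU'; have inU x : x \in U' -> x \in U by rewrite !inE; exact: UU'.
elim: k f => [|k IH] f [cf Df]; first by split=> // x /inU; exact: cf.
have [df Df'] := Df; split; first by move=> x /inU; exact: cf.
by split=> [x v /UU'|v]; [exact: df | exact: IH (Df' v)].
Qed.

(** Openness turns equality on [U] into equality near each of its points, which passes to
    directional derivatives. The inductions below need this because the differentiation rules
    identify derivatives on [U] only. *)
Lemma Ck_eq (V W : normedModType R) k (U : set V) (f g : V -> W) :
  open U -> (forall x, U x -> f x = g x) -> Ck k U f -> Ck k U g.
Proof.
move=> oU; have nearU (h1 h2 : V -> W) : (forall x, U x -> h1 x = h2 x) ->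
    forall x, U x -> \forall y \near x, h1 y = h2 y.
  by move=> h12 x Ux; apply: filterS (open_nbhs_nbhs (conj oU Ux)) => y /h12.
have cont (h1 h2 : V -> W) : (forall x, U x -> h1 x = h2 x) ->
    {in U, continuous h1} -> {in U, continuous h2}.
  move=> h12 c1 x; rewrite inE => Ux.
  have := c1 x; rewrite inE /continuous_at -(h12 _ Ux) => /(_ Ux).
  apply: cvg_trans; apply: near_eq_cvg; exact: nearU.
elim: k f g => [|k IH] f g fg [cf Df]; first by split=> //; exact: cont cf.
have [df Df'] := Df; split; first exact: cont cf.
split=> [x v Ux|v].
- exact: near_eq_derivable (nearU _ _ fg _ Ux) (df _ _ Ux).
- apply: IH (Df' v) => x Ux.
  exact: near_eq_derive (nearU _ _ fg _ Ux).
Qed.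

Lemma Ck_cst (V W : normedModType R) k (U : set V) (a : W) : Ck k U (cst a).
Proof.
elim: k a => [|k IH] a; (split; first by move=> x _; exact: cst_continuous).
  by [].
split=> [x v _|v]; first exact: derivable_cst.
have -> : 'D_v (cst a : V -> W) = cst 0 by apply/funext => x; exact: derive_cst.
exact: IH.
Qed.

Lemma CkD (V W : normedModType R) k (U : set V) (f g : V -> W) :
  open U -> Ck k U f -> Ck k U g -> Ck k U (f + g).
Proof.
move=> oU; elim: k f g => [|k IH] f g [cf Df] [cg Dg];
  (split; first by move=> x Ux; apply: continuousD; [exact: cf | exact: cg]).
  by [].
move: Df Dg => [df Df] [dg Dg]; split=> [x v Ux|v].
  by apply: derivableD; [exact: df | exact: dg].
apply: (@Ck_eq _ _ _ _ ('D_v f + 'D_v g)) => //.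
  by move=> x Ux; rewrite deriveD//; [exact: df | exact: dg].
exact: IH (Df v) (Dg v).
Qed.

Lemma CkM (V : normedModType R) k (U : set V) (f g : V -> R) :
  open U -> Ck k U f -> Ck k U g -> Ck k U (f * g).
Proof.
move=> oU; elim: k f g => [|k IH] f g Cf Cg.
  have [cf _] := Cf; have [cg _] := Cg; split=> // x Ux.
  by apply: continuousM; [exact: cf | exact: cg].
(* The product rule multiplies derivatives by the functions themselves, so the latter are needed at
   the lower order [k] too. *)
have Cf' := CkS Cf; have Cg' := CkS Cg.
move: Cf Cg => [cf [df Df]] [cg [dg Dg]]; split.
  by move=> x Ux; apply: continuousM; [exact: cf | exact: cg].
split=> [x v Ux|v].
  by apply: derivableM; [exact: df | exact: dg].
apply: (@Ck_eq _ _ _ _ (f * 'D_v g + g * 'D_v f)) => //.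
  by move=> x Ux; rewrite deriveM//; [exact: df | exact: dg].
by apply: CkD oU _ _; [exact: IH Cf' (Dg v) | exact: IH Cg' (Df v)].
Qed.

Lemma Ck_sum (V W : normedModType R) k (U : set V) (I : Type) (s : seq I)
    (f : I -> V -> W) :
  open U -> (forall i, Ck k U (f i)) -> Ck k U (\sum_(i <- s) f i).
Proof.
move=> oU Cf; elim: s => [|i s IH]; first by rewrite big_nil; exact: Ck_cst.
by rewrite big_cons; exact: CkD oU (Cf i) IH.
Qed.

Lemma Ck_coord (V : normedModType R) m n k (U : set V) (f : V -> 'M[R]_(m, n))
    i j : open U -> Ck k U f -> Ck k U (fun x => f x i j).
Proof.
move=> oU; elim: k f => [|k IH] f [cf Df];
  (split; first by move=> x Ux;
     apply: (@continuous_comp _ _ _ f (fun A : 'M[R]_(m, n) => A i j));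
     [exact: cf | exact: coord_continuous]).
  by [].
move: Df => [df Df]; split=> [x v Ux|v].
  exact: (derivable_mxP _ _ _).1 (df _ _ Ux) i j.
apply: (@Ck_eq _ _ _ _ (fun x => 'D_v f x i j)) => //.
  by move=> x Ux; rewrite derive_mx ?mxE//; exact: df.
exact: IH (Df v).
Qed.

Lemma Ck_comp_fst (V V' W : normedModType R) k (U : set V) (f : V -> W) :
  Ck k U f -> Ck k (fst @^-1` U : set (V * V')) (f \o fst).
Proof.
elim: k f => [|k IH] f [cf Df];
  (split; first by move=> x; rewrite inE => Ux; apply: continuous_comp;
     [exact: cvg_fst | apply: cf; rewrite inE]).
  by [].
move: Df => [df Df]; split=> [x v Ux|v]; first exact: df.
exact: IH (Df v.1).
Qed.

(** The function is linear: its difference quotients are constant for h != 0, so its directional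
    derivatives are constant functions. *)
Lemma Ck_coord_snd (V : normedModType R) m n k (U : set (V * 'M[R]_(m, n))) i j :
  Ck k U (fun e => e.2 i j).
Proof.
have D e v : is_derive e v (fun e : V * 'M[R]_(m, n) => e.2 i j) (v.2 i j).
  have E : (fun h : R => h^-1 *: (((fun e : V * 'M[R]_(m, n) => e.2 i j) \o shift e)
      (h *: v) - e.2 i j)) @ 0^' --> v.2 i j.
    apply: cvg_near_cst; apply: filterS (nbhs_dnbhs_neq 0) => h h0 /=.
    by rewrite !mxE addrK scalerA mulVf// scale1r.
  by split; [apply/cvg_ex; exists (v.2 i j) | exact: cvg_lim E].
case: k => [|k]; (split; first by move=> x _;
     apply: (@continuous_comp _ _ _ snd (fun A : 'M[R]_(m, n) => A i j));
     [exact: cvg_snd | exact: coord_continuous]).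
  by [].
split=> [x v _|v]; first by have [] := D x v.
have -> : 'D_v (fun e : V * 'M[R]_(m, n) => e.2 i j) = cst (v.2 i j).
  by apply/funext => x; have [] := D x v.
exact: Ck_cst.
Qed.

End CkTheory.

(** * Differentiability from continuous directional derivatives *)

Lemma is_derive_line (R : realType) (V W : normedModType R) (f : V -> W)
    (x v : V) (s : R) :
  derivable f (s *: v + x) v ->
  is_derive (s : R) (1 : R) (fun t : R => f (t *: v + x)) ('D_v f (s *: v + x)).
Proof.
move=> df.
have E : (fun h : R => h^-1 *: (((fun t : R => f (t *: v + x)) \o shift s) (h *: (1 : R))
      - f (s *: v + x))) =
    (fun h : R => h^-1 *: ((f \o shift (s *: v + x)) (h *: v) - f (s *: v + x))).
  apply/funext => h /=; congr (_ *: (f _ - _)).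
  by rewrite [h *: 1]mulr1 scalerDl addrA.
by split; rewrite /derivable /derive E.
Qed.

(** By the mean value theorem the increment is t (df s - c) for some s between 0 and t; the two
    signs of t give the two orientations of the segment. *)
Lemma is_derive_increment_bound (R : realType) (f df : R -> R) (c e t : R) :
  (forall s, `|s| <= `|t| -> is_derive (s : R) (1 : R) f (df s) /\ `|df s - c| <= e) ->
  `|f t - f 0 - t * c| <= e * `|t|.
Proof.
move=> H.
have cont a b : `|a| <= `|t| -> `|b| <= `|t| -> {within `[a, b], continuous f}.
  move=> at_ bt; apply: derivable_within_continuous => s.
  rewrite in_itv /= => /andP[sa sb].
  have [|[]//] := H s; move: at_ bt; rewrite !ler_norml => /andP[? ?] /andP[? ?].
  by apply/andP; split; lra.
have der a b : `|a| <= `|t| -> `|b| <= `|t| ->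
    forall s, s \in `]a, b[ -> is_derive s 1 f (df s).
  move=> at_ bt s; rewrite in_itv /= => /andP[sa sb].
  have [|//] := H s; move: at_ bt; rewrite !ler_norml => /andP[? ?] /andP[? ?].
  by apply/andP; split; lra.
have t0 : `|0 : R| <= `|t| by rewrite normr0.
have tt : `|t| <= `|t| := lexx _.
have [tp|tn] := leP 0 t.
- have [s] := MVT_segment tp (der _ _ t0 tt) (cont _ _ t0 tt).
  rewrite in_itv /= => /andP[s0 st] ->; rewrite subr0 mulrC -mulrBr normrM mulrC.
  have [|_ b] := H s; first by rewrite !ger0_norm.
  by rewrite ler_wpM2r.
- have [s] := MVT_segment (ltW tn) (der _ _ tt t0) (cont _ _ tt t0).
  rewrite in_itv /= => /andP[st s0] E.
  have -> : f t - f 0 - t * c = t * (df s - c) by rewrite -(opprB (f 0)) E; ring.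
  rewrite normrM mulrC.
  have [|_ b] := H s; first by rewrite !ler0_norm// ?lerN2// ltW.
  by rewrite ler_wpM2r.
Qed.

Lemma coord_le_norm (R : realType) (m n : nat) (A : 'M[R]_(m, n)) i j :
  `|A i j| <= `|A|.
Proof.
rewrite [leRHS]/Num.Def.normr/= mx_normrE.
exact: (le_bigmax _ (fun ij : 'I_m * 'I_n => `|A ij.1 ij.2|) (i, j)).
Qed.

Lemma norm_le_coord (R : realType) (m n : nat) (A : 'M[R]_(m, n)) (c : R) :
  0 <= c -> (forall i j, `|A i j| <= c) -> `|A| <= c.
Proof.
move=> c0 H; rewrite /Num.Def.normr/= mx_normrE.
by apply: bigmax_le => // -[i j] _; exact: H.
Qed.

Lemma differentiable_of_increment (R : realType) (V W : normedModType R)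
    (f : V -> W) (L : {linear V -> W}) x :
  continuous L ->
  (forall e : R, 0 < e ->
     \forall h \near (0 : V), `|f (h + x) - f x - L h| <= e * `|h|) ->
  differentiable f x.
Proof.
move=> Lc fL.
have fE : f \o shift x = cst (f x) + L +o_ 0 id.
  apply/eqaddoP => _/posnumP[e].
  have := fL _ [gt0 of e%:num].
  by apply: filterS => h; rewrite /= opprD addrA.
have E := diff_unique Lc fE.
by apply/diff_locallyP; rewrite E; split; [exact: Lc | exact: fE].
Qed.

Section Differentiable.
Context {R : realType} {m : nat}.
Implicit Types (U : set 'rV[R]_m).

(** The points [trunc h k + x] are the successive vertices of an axis-parallel path from [x] to
    [h + x]. *)
Let trunc (h : 'rV[R]_m) (k : nat) : 'rV[R]_m :=
  \row_j (if (j < k)%N then h 0 j else 0).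

(* Change one coordinate at a time; the mean value theorem bounds each step. *)
Lemma C1_increment_bound U (f : 'rV[R]_m -> R) x (e : R) :
  open U -> Ck 1 U f -> U x -> 0 < e ->
  \forall h \near (0 : 'rV[R]_m), `|f (h + x) - f x - \sum_(k < m) h 0 k * 'D_(delta_mx 0 k) f x|
    <= e * `|h|.
Proof.
move=> oU [_ [df Df]] Ux e0.
(* There are [m] steps, each costing at most e' |h|; the successor keeps the denominator nonzero
   when m = 0. *)
pose e' := e / m.+1%:R.
have e'0 : 0 < e' by rewrite divr_gt0.
have : \forall y \near x, U y /\
    forall k : 'I_m, `|'D_(delta_mx 0 k) f y - 'D_(delta_mx 0 k) f x| <= e'.
  apply: filterI; first exact: open_nbhs_nbhs.
  refine (@filter_forall _ _ (fun (k : 'I_m) (y : 'rV[R]_m) =>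
    `|'D_(delta_mx 0 k) f y - 'D_(delta_mx 0 k) f x| <= e') (nbhs x) _ _) => k.
  have [Dc _] := Df (delta_mx 0 k).
  have /cvgrPdist_le /(_ _ e'0) := Dc _ (mem_set Ux).
  by apply: filterS => y; rewrite distrC.
move=> /nbhs_ballP[d /= d0 xd].
have smallh : \forall h \near (0 : 'rV[R]_m), `|h| < d.
  by apply/nbhs_norm0P; exists d.
near=> h.
have hd : `|h| < d.
  exact: (near smallh h).
have T0 : trunc h 0 = 0 by apply/rowP => j; rewrite !mxE.
have Tm : trunc h m = h by apply/rowP => j; rewrite !mxE ltn_ord.
have -> : f (h + x) - f x =
    \sum_(k < m) (f (trunc h k.+1 + x) - f (trunc h k + x)).
  rewrite -(big_mkord xpredT (fun k => f (trunc h k.+1 + x) - f (trunc h k + x))).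
  by rewrite (telescope_sumr (fun k => f (trunc h k + x)) (leq0n m)) T0 Tm add0r.
rewrite -sumrB.
have term (k : 'I_m) : `|f (trunc h k.+1 + x) - f (trunc h k + x) -
    h 0 k * 'D_(delta_mx 0 k) f x| <= e' * `|h|.
  have hk : `|h 0 k| <= `|h| by exact: coord_le_norm.
  have := @is_derive_increment_bound _
    (fun s => f (s *: delta_mx 0 k + (trunc h k + x)))
    (fun s => 'D_(delta_mx 0 k) f (s *: delta_mx 0 k + (trunc h k + x)))
    ('D_(delta_mx 0 k) f x) e' (h 0 k).
  rewrite scale0r add0r addrA.
  have -> : h 0 k *: delta_mx 0 k + trunc h k = trunc h k.+1.
    apply/rowP => j; rewrite !mxE eqxx /= -(val_eqE j k) /= ltnS.
    by case: ltngtP => [_|_|/val_inj->]; rewrite ?mulr0 ?add0r ?mulr1 ?addr0.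
  move=> H; apply: le_trans (H _) _; last by rewrite ler_wpM2l// ltW.
  move=> s sh.
  (* The displacement has coordinates [s], some [h 0 j], or 0, all bounded by |h| in the sup norm,
     so the point stays in the ball of radius [d]. *)
  have [|Uy Dy] := xd (s *: delta_mx 0 k + (trunc h k + x)).
    rewrite -ball_normE /= addrA distrC addrK.
    apply: le_lt_trans hd; apply: norm_le_coord => // i j.
    rewrite !mxE ord1 eqxx /=.
    have [->|jk] := eqVneq j k.
      by rewrite ?ltnn ?mulr1 ?addr0 (le_trans sh).
    rewrite mulr0 add0r; case: ifP => _; first exact: coord_le_norm.
    by rewrite normr0.
  split; last exact: Dy.
  by apply: is_derive_line; exact: df.
apply: le_trans (ler_norm_sum _ _ _) _.
apply: le_trans (ler_sum _ (fun k _ => term k)) _.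
rewrite sumr_const card_ord -mulr_natl mulrA ler_wpM2r//.
rewrite /e' mulrCA ler_piMr ?(ltW e0)//.
by rewrite ler_pdivrMr// mul1r ler_nat.
Unshelve. all: by end_near. Qed.

Lemma C1_differentiable_real U (f : 'rV[R]_m -> R) x :
  open U -> Ck 1 U f -> U x -> differentiable f x.
Proof.
move=> oU Cf Ux.
pose L (h : 'rV[R]_m) : R := \sum_(k < m) h 0 k * 'D_(delta_mx 0 k) f x.
have Llin : linear L.
  move=> a u v; rewrite /L scaler_sumr -big_split; apply: eq_bigr => k _ /=.
  by rewrite !mxE mulrDl -mulrA.
pose LM := GRing.isLinear.Build _ _ _ _ _ Llin.
pose LL : {linear _ -> _} := HB.pack L LM.
have Lc : continuous LL.
  suff H (s : seq 'I_m) :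
      continuous (fun h : 'rV[R]_m => \sum_(k <- s) h 0 k * 'D_(delta_mx 0 k) f x).
    exact: H.
  elim: s => [|k s IH].
    by under eq_fun do rewrite big_nil; exact: cst_continuous.
  under eq_fun do rewrite big_cons.
  move=> h; apply: (@continuousD _ _ _ (fun h : 'rV[R]_m => h 0 k * 'D_(delta_mx 0 k) f x)).
    by apply: continuousM; [exact: coord_continuous | exact: cst_continuous].
  exact: IH.
apply: (differentiable_of_increment Lc) => e e0.
exact (C1_increment_bound oU Cf Ux e0).
Qed.

Lemma C1_differentiable n U (f : 'rV[R]_m -> 'rV[R]_n) x :
  open U -> Ck 1 U f -> U x -> differentiable f x.
Proof.
move=> oU Cf Ux.
have -> : f = \sum_(j < n) (fun y => f y 0 j *: delta_mx 0 j).
  by apply/funext => y; rewrite fct_sumE; exact: row_sum_delta.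
apply: differentiable_sum => j; apply: differentiableZl.
exact: C1_differentiable_real oU (Ck_coord 0 j oU Cf) Ux.
Qed.

End Differentiable.

(** * Charts of the tangent bundle *)

Lemma near_eq_diff (R : realType) (V W : normedModType R) (f g : V -> W) x v :
  (\forall y \near x, f y = g y) -> differentiable f x -> differentiable g x ->
  'd f x v = 'd g x v.
Proof.
move=> fg df dg; rewrite -(deriveE v df) -(deriveE v dg).
exact: near_eq_derive.
Qed.

Section Transitions.
Context {R : realType} {n : nat} {M : smoothManifold R n}.
Implicit Types (i j k : chart_index M) (p : M).

(** Within the open image of chart [i], the overlap is where [chart_inv i] lands in the open set
    [chart_dom j]; continuity of [chart_inv i] concludes. *)
Lemma overlap_open i j : open (chart i @` (chart_dom i `&` chart_dom j)).
Proof.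
rewrite openE => _ [p [ip jp] <-].
have imgi : (chart i @` chart_dom i) (chart i p) by exists p.
have := chart_inv_continuous (mem_set imgi).
rewrite /continuous_at chartK// => /(_ _ (open_nbhs_nbhs (conj (chart_dom_open j) jp))).
have := open_nbhs_nbhs (conj (@chart_img_open _ _ _ i) imgi).
apply: filterS2 => y [q iq <-] /=; rewrite chartK// => jq.
by exists q.
Qed.

Lemma transition_differentiable i j p : chart_dom i p -> chart_dom j p ->
  differentiable (chart j \o chart_inv i) (chart i p).
Proof.
move=> ip jp.
apply: (C1_differentiable (@overlap_open i j) (chart_transition i j 1%N)).
by exists p.
Qed.

Lemma near_chart i j p : chart_dom i p -> chart_dom j p ->
  \forall y \near chart i p, exists q,
    [/\ chart_dom i q, chart_dom j q & y = chart i q].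
Proof.
move=> ip jp; have imgi : (chart i @` (chart_dom i `&` chart_dom j)) (chart i p).
  by exists p.
have := open_nbhs_nbhs (conj (@overlap_open i j) imgi).
by apply: filterS => _ [q [iq jq] <-]; exists q.
Qed.

Lemma diff_transition_refl i p (v : 'rV[R]_n) : chart_dom i p ->
  'd (chart i \o chart_inv i) (chart i p) v = v.
Proof.
move=> ip; have E : \forall y \near chart i p, (chart i \o chart_inv i) y = id y.
  by apply: filterS (near_chart ip ip) => _ [q [iq _ ->]] /=; rewrite chartK.
rewrite (near_eq_diff v E (transition_differentiable ip ip)); last exact: ex_diff.
by rewrite diff_val.
Qed.

(** The cocycle condition: near [chart i p] the transition from [i] to [k] factors through [j], and
    the chain rule applies. *)
Lemma diff_transition_comp i j k p (v : 'rV[R]_n) :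
  chart_dom i p -> chart_dom j p -> chart_dom k p ->
  'd (chart k \o chart_inv i) (chart i p) v =
  'd (chart k \o chart_inv j) (chart j p) ('d (chart j \o chart_inv i) (chart i p) v).
Proof.
move=> ip jp kp.
have dij := transition_differentiable ip jp.
have djk : differentiable (chart k \o chart_inv j) ((chart j \o chart_inv i) (chart i p)).
  by rewrite /= (chartK ip); exact: transition_differentiable jp kp.
have E : \forall y \near chart i p, (chart k \o chart_inv i) y =
    ((chart k \o chart_inv j) \o (chart j \o chart_inv i)) y.
  apply: filterS (near_chart ip jp) => _ [q [iq jq ->]] /=.
  by rewrite (chartK iq) (chartK jq).
have dcomp := differentiable_comp dij djk.
refine (etrans (near_eq_diff v E (transition_differentiable ip kp) dcomp) _).
refine (etrans (congr1 (fun h => h v) (diff_comp dij djk)) _).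
by rewrite /= (chartK ip).
Qed.

(** The vector is carried from chart [i] to every other chart around [p] by the differentials of the
    transitions; the cocycle condition makes the family compatible. *)
Lemma tangent_surj i p (v : 'rV[R]_n) : chart_dom i p ->
  exists w : tangent p, w i = v.
Proof.
move=> ip.
pose w j := if `[< chart_dom j p >] then
  'd (chart j \o chart_inv i) (chart i p) v else 0.
have wE j : chart_dom j p -> w j = 'd (chart j \o chart_inv i) (chart i p) v.
  by move=> jp; rewrite /w; case: asboolP.
have wT : is_tangent p w.
  apply/asboolP; split=> [j jp|j k jp kp]; first by rewrite /w; case: asboolP.
  by rewrite !wE//; exact: diff_transition_comp.
by exists (Tangent wT); rewrite /= wE// diff_transition_refl.
Qed.

Lemma tangent_coord_eq0 i p (w : tangent p) : chart_dom i p ->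
  w i = 0 -> w = 0.
Proof.
move=> ip wi0; apply/val_inj/funext => j /=.
have /asboolP[w0 wP] := tangentP w.
have [jp|jp] := pselect (chart_dom j p); last exact: w0.
by rewrite (wP i j ip jp) wi0 linear0.
Qed.

Local Notation E := ('rV[R]_n * 'rV[R]_n)%type.
Implicit Types (W : set (tangentBundle M)).

Lemma tb_open_mem i W : open W -> exists2 U : set E, open U &
  forall u, chart_dom i (foot u) -> (W u <-> U (tchart i u)).
Proof.
move=> oW; have [U oU E] := (oW : tb_open W) i; exists U => // u iu.
have [h1 h2] : (tchart_dom i `&` W) u <-> (tchart_dom i `&` tchart i @^-1` U) u.
  by rewrite E.
by split=> H; [case: (h1 (conj iu H)) | case: (h2 (conj iu H))].
Qed.

(** Membership in an open [W] is decided by the value of the bundle chart, through the open set of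
    [tb_open_mem]. *)
Lemma tchart_img_mem i W u : open W -> chart_dom i (foot u) ->
  (tchart i @` (tchart_dom i `&` W)) (tchart i u) -> W u.
Proof.
move=> oW iu [u' [iu' Wu'] E]; have [U oU WU] := tb_open_mem i oW.
by apply/WU => //; rewrite -E; apply/WU.
Qed.

(** The image is an open set of coordinates cut by the cylinder over the chart image; [tangent_surj]
    realizes every point of this intersection. *)
Lemma tchart_img_open i W : open W ->
  open (tchart i @` (tchart_dom i `&` W)).
Proof.
move=> oW; have [U oU WU] := tb_open_mem i oW.
have -> : tchart i @` (tchart_dom i `&` W) =
    fst @^-1` (chart i @` chart_dom i) `&` U.
  apply/seteqP; split=> [_ [u [iu Wu] <-]|[x v] [[p ip /= <-] Ux]].
    by split; [exists (foot u) | apply/WU].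
  have [w wi] := tangent_surj v ip.
  have E : tchart i (TVec p w) = (chart i p, v) by rewrite /tchart /= wi.
  by exists (TVec p w) => //; split=> //; apply/WU => //; rewrite E.
apply: openI => //; apply: open_comp; last exact: chart_img_open.
by move=> x _; exact: cvg_fst.
Qed.

Lemma open_setD_zero W : open W -> open (W `\` zero_vectors (M := M)).
Proof.
move=> oW; rewrite -[open _]/(tb_open _) => i; have [U oU WU] := tb_open_mem i oW.
exists (U `&` [set e | e.2 != 0]).
  apply: openI => //; apply: (@open_comp _ _ (snd : E -> _) [set x | x != 0]).
    by move=> x _; exact: cvg_snd.
  have -> : [set x : 'rV[R]_n | x != 0] = ~` [set 0].
    by apply/seteqP; split=> x /= /eqP.
  apply: closed_openC; apply: accessible_closed_set1.
  by apply: hausdorff_accessible; exact: norm_hausdorff.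
apply/seteqP; split=> u [iu].
- move=> [Wu u0]; split=> //; split; first exact/WU.
  by apply/eqP => ui0; apply: u0; exact: tangent_coord_eq0 iu ui0.
- move=> [Uu /eqP u0]; split=> //; split; first exact/WU.
  by move=> uz; apply: u0; rewrite /= uz.
Qed.

Lemma tb_smoothW W W' (F : tangentBundle M -> R) :
  W' `<=` W -> tb_smooth W F -> tb_smooth W' F.
Proof.
move=> WW' sF i; have [f Cf Ff] := sF i; exists f.
  by move=> k; apply: CkW (Cf k) => _ [u [iu /WW' Wu] <-]; exists u.
by move=> u iu /WW'; exact: Ff.
Qed.

(** The topology of the bundle is read in charts, where the local representative is continuous on
    the open image of [W]. *)
Lemma tb_smooth_preimage_open W (F : tangentBundle M -> R) (V : set R) :
  open W -> tb_smooth W F -> open V -> open (W `&` F @^-1` V).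
Proof.
move=> oW sF oV; rewrite -[open _]/(tb_open _) => i; have [f Cf Ff] := sF i.
have oI := @tchart_img_open i W oW; have [fc _] := Cf 0%N.
exists ((tchart i @` (tchart_dom i `&` W)) `&` f @^-1` V).
  rewrite openE => e [Ie Ve].
  have nV : nbhs e (f @^-1` V).
    exact: fc _ (mem_set Ie) _ (open_nbhs_nbhs (conj oV Ve)).
  exact: filterI (open_nbhs_nbhs (conj oI Ie)) nV.
apply/seteqP; split=> u [iu].
- by move=> [Wu Vu]; split=> //; split; [exists u | rewrite /= -Ff].
- move=> [Iu Vu]; have Wu := tchart_img_mem oW iu Iu.
  by split=> //; split=> //; rewrite /= Ff.
Qed.

Lemma tb_smoothD_oneform W (F : tangentBundle M -> R) (beta : oneForm M) :
  open W -> tb_smooth W F -> tb_smooth W (fun u => F u + oneform_eval beta u).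
Proof.
move=> oW sF i; have [f Cf Ff] := sF i; have [b Cb Bb] := oneform_smooth beta i.
have oI := @tchart_img_open i W oW.
(* In coordinates (x, y) the one-form is the sum of the b_j(x) y_j. *)
exists (f + \sum_(j < n) (fun e : E => b e.1 0 j) * (fun e : E => e.2 0 j)).
  move=> k; apply: CkD => //; apply: Ck_sum => // j; apply: CkM => //.
    apply: (Ck_coord 0 j oI (f := b \o fst)).
    have Cb1 := @Ck_comp_fst R _ 'rV[R]_n _ k _ b (Cb k).
    apply: CkW Cb1 => _ [u [iu _] <-] /=.
    by exists (foot u).
  exact: Ck_coord_snd.
move=> u iu Wu; rewrite (Ff _ iu Wu) /oneform_eval (Bb _ _ iu).
by rewrite addrfctE fct_sumE.
Qed.

End Transitions.

(** * Smooth functions along lines in a fibre *)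

Section Lines.
Context {R : realType} {n : nat} {M : smoothManifold R n}.
Variables (W : set (tangentBundle M)) (F : tangentBundle M -> R).
Hypotheses (oW : open W) (sF : tb_smooth W F).
Variables (p : M) (v w : tangent p).
Hypothesis Wv : W (TVec p v).

Let tchart_line i (s : R) :
  tchart i (TVec p (v + s *: w)) = s *: (0, w i) + tchart i (TVec p v).
Proof.
have -> : s *: (0, w i) + tchart i (TVec p v) =
    (s *: 0 + chart i p, s *: w i + v i) by [].
by rewrite scaler0 add0r addrC.
Qed.

Lemma near_line : \forall s \near (0 : R), W (TVec p (v + s *: w)).
Proof.
have [i ip] := chart_cover p; have [U oU WU] := tb_open_mem i oW.
pose l (s : R) : 'rV[R]_n * 'rV[R]_n := s *: (0, w i) + tchart i (TVec p v).
have lc : {for 0, continuous l}.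
  apply: continuousD; last exact: cst_continuous.
  exact: scalel_continuous.
have Ul : nbhs (l 0) U.
  apply: open_nbhs_nbhs; split=> //; rewrite /l scale0r add0r.
  exact: (WU (TVec p v) ip).1.
have nU : \forall s \near (0 : R), U (l s) by exact: lc _ Ul.
apply: filterS nU => s Us; apply: (WU (TVec p (v + s *: w)) ip).2.
by rewrite tchart_line.
Qed.

(** A line in the fibre becomes an affine line of direction (0, w i) in a bundle chart, so
    differentiating along it is applying ['D_d] to a C^2 representative. *)
Lemma twice_derivable_line : twice_derivable (line_fun F v w) 0.
Proof.
have [i ip] := chart_cover p; have [f Cf Ff] := sF i.
have [_ [df Df]] := Cf 2%N.
pose d : 'rV[R]_n * 'rV[R]_n := (0, w i); pose e := tchart i (TVec p v).
have Il : \forall s \near (0 : R),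
    (tchart i @` (tchart_dom i `&` W)) (s *: d + e).
  apply: filterS near_line => s Ws; exists (TVec p (v + s *: w)).
    by split.
  exact: tchart_line.
have fE : \forall s \near (0 : R), f (s *: d + e) = line_fun F v w s.
  apply: filterS near_line => s Ws; rewrite /line_fun Ff//.
  by rewrite tchart_line.
apply: (near_eq_twice_derivable fE).
have d1 : \forall s \near (0 : R),
    is_derive (s : R) (1 : R) (fun s : R => f (s *: d + e)) ('D_d f (s *: d + e)).
  by apply: filterS Il => s Is; apply: is_derive_line; exact: df.
have [_ [ddf _]] := Df d.
have d2 : is_derive (0 : R) (1 : R) (fun s : R => 'D_d f (s *: d + e))
    ('D_d ('D_d f) (0 *: d + e)).
  by apply: is_derive_line; apply: ddf; exact: nbhs_singleton Il.
by have [] := near_is_derive_twice d1 d2.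
Qed.

End Lines.

(** Serves the degenerate case of positivity, where the transverse part of [w] is zero. *)
Lemma fundamental_tensor00 (R : realType) (n : nat) (M : smoothManifold R n)
    (F : tangentBundle M -> R) (p : M) (v : tangent p) :
  fundamental_tensor F v 0 0 = 0.
Proof.
rewrite /fundamental_tensor.
under eq_fun do under eq_fun do rewrite !scaler0 !addr0.
by under eq_fun do rewrite derive1_cst; rewrite derive1_cst mulr0.
Qed.

Lemma continuous_within_preimage_open (T : topologicalType) (R : realType)
    (A : set T) (F : T -> R) :
  (forall V : set R, open V -> open (A `&` F @^-1` V)) ->
  {within A, continuous F}.
Proof.
move=> oF; have oA : open A.
  by rewrite -(setIT A) -(preimage_setT F); exact: oF openT.
rewrite continuous_open_subspace// => u /set_mem Au V.
rewrite {1}nbhsE /= => -[V' [oV' V'u] V'V].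
have : nbhs u (A `&` F @^-1` V') by apply: open_nbhs_nbhs; split=> //; exact: oF.
by apply: filterS => t [_ /V'V].
Qed.

(** * Adding a one-form to a conic Finsler metric *)

Section Randers.
Context {R : realType} {n : nat} {M : smoothManifold R n}.
Variables (A0 : set (tangentBundle M)) (F0 : tangentBundle M -> R).
Variable beta : oneForm M.
Hypothesis cF0 : conic_finsler_metric A0 F0.
Let F := fun u : tangentBundle M => F0 u + oneform_eval beta u.
Let A := [set u | A0 u /\ 0 < F0 u + oneform_eval beta u].
(** The open set on which [F0], hence [F], is smooth; it contains [A]. *)
Let W := A0 `\` zero_vectors (M := M).

Let oW : open W.
Proof. exact: open_setD_zero (cf_open cF0). Qed.

Let sF0 : tb_smooth W F0.
Proof. exact: cf_smooth cF0. Qed.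

Let sF : tb_smooth W F.
Proof. exact: tb_smoothD_oneform. Qed.

Lemma randers_domain_nonzero u : A u -> ~ zero_vectors u.
Proof.
move=> [A0u Fu] u0; have F0u := (cf_eq0 cF0 A0u).2 u0.
by move: Fu; rewrite F0u /oneform_eval u0 linear0 addr0 ltxx.
Qed.

Let AW : A `<=` W.
Proof. by move=> u Au; split; [case: Au | exact: randers_domain_nonzero]. Qed.

Let A_preimage_open (V : set R) : open V -> open (A `&` F @^-1` V).
Proof.
move=> oV.
(* [A] is the part of [W] where [F] is positive. One statement about smooth functions thus yields
   both openness of [A] (with [V] everything) and continuity of [F] on it. *)
have -> : A `&` F @^-1` V = W `&` F @^-1` ([set x | 0 < x] `&` V).
  apply/seteqP; split=> u.
  - by move=> [Au Vu]; split; [exact: AW | split=> //; case: Au].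
  - by move=> [[A0u _] [Fu Vu]].
apply: tb_smooth_preimage_open => //.
by apply: openI => //; exact: open_gt.
Qed.

Let F0_gt0 u : W u -> 0 < F0 u.
Proof.
move=> [A0u u0]; rewrite lt_neqAle (cf_ge0 cF0 A0u) andbT eq_sym.
by apply/eqP => /(cf_eq0 cF0 A0u).
Qed.

Section Vectors.
Variables (p : M) (v w : tangent p).
Hypothesis Av : A (TVec p v).
Let f := line_fun F0 v w.

Let Wv : W (TVec p v). Proof. exact: AW. Qed.

Let f2 : twice_derivable f 0.
Proof. exact: (@twice_derivable_line _ _ _ W F0 oW sF0 p v w Wv). Qed.

Let A0line : \forall s \near (0 : R), A0 (TVec p (v + s *: w)).
Proof. exact: (@near_line _ _ _ A0 (cf_open cF0) p v w (proj1 Wv)). Qed.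

(** The common source of the formula and of positivity. *)
Lemma randers_tensor_line :
  fundamental_tensor F v w w =
    (derive1 f 0 + oneform_at beta p w) ^+ 2
    + (F0 (TVec p v) + oneform_at beta p v) * derive1 (derive1 f) 0.
Proof.
have E : line_fun F v w =
    fun s => f s + (oneform_at beta p v + s * oneform_at beta p w).
  apply/funext => s; rewrite /line_fun /F /oneform_eval /=.
  by rewrite linearD linearZ.
have [g2 g0 g1] := add_affine_twice (oneform_at beta p v) (oneform_at beta p w) f2.
by rewrite fundamental_tensor_diag E ?g0 ?g1.
Qed.

Lemma randers_tensor_eq :
  fundamental_tensor F v w w =
    (F0 (TVec p v) + oneform_at beta p v) / F0 (TVec p v) *
      angular_metric F0 v w
    + (fundamental_tensor F0 v v w / F0 (TVec p v) + oneform_at beta p w) ^+ 2.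
Proof.
have a0 : F0 (TVec p v) != 0 by rewrite gt_eqF// F0_gt0.
rewrite randers_tensor_line.
rewrite (angular_metricE (cf_homogeneous cF0) A0line f2 a0).
rewrite (fundamental_tensor_radial (cf_homogeneous cF0) A0line f2) -/f.
by field.
Qed.

Lemma randers_tensor_posdef : w <> 0 -> 0 < fundamental_tensor F v w w.
Proof.
move=> w0; have a0 := F0_gt0 Wv; have an : F0 (TVec p v) != 0 by rewrite gt_eqF.
have [A0v Fv] := Av; rewrite /= /oneform_eval /= in Fv.
have v0 : v <> 0 by case: Wv.
rewrite randers_tensor_line.
pose c := derive1 f 0 / F0 (TVec p v).
have ac : F0 (TVec p v) * c = derive1 f 0 by rewrite /c; field.
have T := fundamental_tensor_transverse (cf_homogeneous cF0) A0line f2 ac.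
(* If w = c v then [T] forces f'' = 0 and the square must be positive; otherwise positivity of the
   tensor of [F0] at w - c v gives f'' > 0. *)
rewrite -/f in T; have [wc|wc] := eqVneq (w - c *: v) 0.
- have f20 : derive1 (derive1 f) 0 = 0.
    apply/eqP; rewrite -(mulrI_eq0 _ (mulfI an)) -T wc.
    by rewrite fundamental_tensor00.
  move/subr0_eq: wc => wc.
  have c0 : c != 0 by apply/eqP => c0; apply: w0; rewrite wc c0 scale0r.
  rewrite f20 mulr0 addr0 -ac [w in oneform_at beta p w]wc linearZ /=.
  have -> : F0 (TVec p v) * c + c * oneform_at beta p v =
      c * (F0 (TVec p v) + oneform_at beta p v) by ring.
  have cF := mulf_neq0 c0 (lt0r_neq0 Fv).
  by rewrite lt_neqAle sqr_ge0 andbT eq_sym sqrf_eq0.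
- have := cf_posdef cF0 A0v v0 (elimN eqP wc); rewrite T (pmulr_rgt0 _ a0) => f2p.
  exact: ltr_wpDl (sqr_ge0 _) (mulr_gt0 Fv f2p).
Qed.

End Vectors.

Lemma randers_conic_finsler : foot @` A = setT -> conic_finsler_metric A F.
Proof.
move=> projA.
have hom p (v : tangent p) (lambda : R) : A (TVec p v) -> 0 < lambda ->
    F (TVec p (lambda *: v)) = lambda * F (TVec p v).
  move=> [A0v _] l0; rewrite /F (cf_homogeneous cF0 A0v l0) /oneform_eval /=.
  by rewrite linearZ mulrDr.
split.
- by rewrite -(setIT A) -(preimage_setT F); exact: A_preimage_open openT.
- move=> p v lambda Av l0; split; first exact: cf_conic cF0 _ _ _ (proj1 Av) l0.
  by have := hom _ _ _ Av l0; rewrite /F => ->; case: Av => _ Fv; exact: mulr_gt0.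
- exact: projA.
- by move=> u [_ /ltW].
- exact: continuous_within_preimage_open A_preimage_open.
- by apply: tb_smoothW sF => u [/AW].
(* On [A] both sides are false: [F] is positive there and no zero vector belongs to it. *)
- move=> u Au; split=> [Fu|/(randers_domain_nonzero Au)//].
  by case: Au => _; rewrite -[X in 0 < X]/(F u) Fu ltxx.
- exact: hom.
- by move=> p v Av _ w w0; exact (@randers_tensor_posdef p v w Av w0).
Qed.

End Randers.

Theorem corollary4p17 (R : realType) (n : nat) (M : smoothManifold R n)
    (A0 : set (tangentBundle M)) (F0 : tangentBundle M -> R)
    (beta : oneForm M) :
  conic_finsler_metric A0 F0 ->
  let F := fun u : tangentBundle M => F0 u + oneform_eval beta u in
  let A := [set u | A0 u /\ 0 < F0 u + oneform_eval beta u] in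
  foot @` A = setT ->
  conic_finsler_metric A F /\
  forall (p : M) (v w : tangent p), A (TVec p v) -> v <> 0 ->
    fundamental_tensor F v w w =
      (F0 (TVec p v) + oneform_at beta p v) / F0 (TVec p v) *
        angular_metric F0 v w
      + (fundamental_tensor F0 v v w / F0 (TVec p v) + oneform_at beta p w) ^+ 2.
Proof.
move=> cF0 F A projA; split; first exact: randers_conic_finsler.
by move=> p v w Av _; exact (randers_tensor_eq cF0 w Av).
Qed.
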